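(* There exists a family of $\mathbb{Q}$-linear maps $\mathfrak{H}\to\mathfrak{H}$, one attached to each rooted forest $f$ and also denoted $f$, with the map attached to the empty forest $\mathbb{I}$ being the identity, such that: (i) $\bullet(x)=xy$ and $\bullet(y)=-xy$, where $\bullet$ is the one-vertex tree; (i') for every nonempty rooted forest $f$ and $u\in\{x,y\}$, $f(u)\in\mathfrak{H}y$ and $B_+(f)(u)=R_yR_{y+z}R_y^{-1}f(u)$ (i.e. if $f(u)=vy$ then $B_+(f)(u)=vy(y+z)y$); (i'') if $f=gh$ with $g,h\neq\mathbb{I}$ rooted forests, then $f(u)=g(h(u))$ for $u\in\{x,y\}$; (ii) for every nonempty rooted forest $f$, every $w\in\mathfrak{H}$ and $u\in\{x,y\}$, $f(wu)=M(\Delta(f)(w\otimes u))$.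
   Context: A rooted tree is a finite tree with a distinguished vertex (the root), considered non-planar (no ordering of the children of a vertex). A rooted forest is a finite multiset of rooted trees (a formal commutative product of rooted trees); the empty forest is denoted $\mathbb{I}$. The degree of a forest is its number of vertices. $H$ is the commutative $\mathbb{Q}$-algebra with basis the rooted forests, product given by disjoint union and unit $\mathbb{I}$. The grafting operator $B_+:H\to H$ is the linear map sending a forest $t_1\cdots t_n$ to the rooted tree obtained by adding a new vertex, which becomes the root, joined by edges to the roots of $t_1,\dots,t_n$; $B_+(\mathbb{I})=\bullet$ is the one-vertex tree. Every rooted tree $t$ equals $B_+(f)$ for a unique forest $f$. The coproduct $\Delta:H\to H\otimes H$ is the algebra homomorphism with $\Delta(\mathbb{I})=\mathbb{I}\otimes\mathbb{I}$ and $\Delta(B_+(f))=B_+(f)\otimes\mathbb{I}+(\mathrm{id}\otimes B_+)(\Delta(f))$ for every forest $f$. $\mathfrak{H}=\mathbb{Q}\langle x,y\rangle$ is the noncommutative polynomial algebra, $z=x+y$, $R_u(w)=wu$ and $L_u(w)=uw$ are right and left multiplication by $u$, $R_y^{-1}$ denotes the inverse of $R_y$ on $\mathfrak{H}y$, and $M:\mathfrak{H}\otimes\mathfrak{H}\to\mathfrak{H}$, $M(v\otimes w)=vw$. For $\Delta(f)=\sum a\otimes b$ (a finite sum of tensors of forests), $\Delta(f)(v\otimes w)$ means $\sum a(v)\otimes b(w)$, using the maps attached to the forests $a,b$.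
   Formalization: In (i') the parenthetical should read: if f(u)=vy then B_+(f)(u)=v(y+z)y; the printed vy(y+z)y contradicts R_yR_{y+z}R_y^{-1}f(u) (e.g. f=•, u=x), and the operator formula is what is formalized. *)

(* Defs.v *)
From HB Require Import structures.
From mathcomp Require Import all_boot all_order all_algebra.
From mathcomp Require Import finmap.
From mathcomp.multinomials Require Import monalg.

Set Implicit Arguments.
Unset Strict Implicit.
Unset Printing Implicit Defensive.

Import GRing.Theory.
Local Open Scope ring_scope.

(* The tensor product of the free modules on K and L is represented as the    *)
(* free module on K * L; when K and L are monoids, K * L carries the          *)
(* componentwise product, so that (a (x) b) (c (x) d) = ac (x) bd.            *)
Section PairMonom.
Variables K L : conomType.

Definition pairm_mul (p q : K * L) : K * L :=
  (mmul p.1 q.1, mmul p.2 q.2).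

Lemma pairm_mulA : associative pairm_mul.
Proof. by move=> p q r; rewrite /pairm_mul /= !mulmA. Qed.

Lemma pairm_mul1m : left_id (mone, mone) pairm_mul.
Proof. by case=> a b; rewrite /pairm_mul /= !mul1m. Qed.

Lemma pairm_mulm1 : right_id (mone, mone) pairm_mul.
Proof. by case=> a b; rewrite /pairm_mul /= !mulm1. Qed.

Lemma pairm_unitm p q :
  pairm_mul p q = (mone, mone) -> p = (mone, mone) /\ q = (mone, mone).
Proof.
by case: p q => [a b] [c d] [] /unitm[-> ->] /unitm[-> ->].
Qed.

Lemma pairm_mulC : commutative pairm_mul.
Proof. by move=> p q; rewrite /pairm_mul mulmC [mmul p.2 _]mulmC. Qed.

HB.instance Definition _ := Choice_isMonomialDef.Build (K * L)%type
  pairm_mulA pairm_mul1m pairm_mulm1 pairm_unitm.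
HB.instance Definition _ := MonomialDef_isConomialDef.Build (K * L)%type
  pairm_mulC.
End PairMonom.

Lemma malgUZ (K : choiceType) (c : rat) (k : K) :
  << c *g k >> = c *: << k >> :> {malg rat[K]}.
Proof. by apply/malgP => l; rewrite mcoeffZ !mcoeffU mulr_natr. Qed.

Lemma malgZAr (K : monomType) (c : rat) (g1 g2 : {malg rat[K]}) :
  g1 * (c *: g2) = c *: (g1 * g2).
Proof.
suff E : g1 * c%:MP = c%:MP * g1 by rewrite -!mul_malgC !mulrA E.
rewrite !malgM_def fgmulgU fgmulUg; apply: eq_bigr => k _.
by rewrite mulrC mulm1 mul1m.
Qed.

Section LinExt.
Variables (K : choiceType) (V : lmodType rat) (h : K -> V).

Definition lin_ext (g : {malg rat[K]}) : V := \sum_(k <- msupp g) g@_k *: h k.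

Lemma lin_extEw (d : {fset K}) g : (msupp g `<=` d)%fset ->
  lin_ext g = \sum_(k <- d) g@_k *: h k.
Proof.
move=> le; rewrite /lin_ext; apply: (big_fset_incl _ le) => k _ /mcoeff_outdom ->.
by rewrite scale0r.
Qed.

Lemma lin_ext_is_linear : linear lin_ext.
Proof.
move=> c g1 g2; pose d := (msupp g1 `|` msupp g2)%fset.
have le1 : (msupp g1 `<=` d)%fset by exact: fsubsetUl.
have le2 : (msupp g2 `<=` d)%fset by exact: fsubsetUr.
have le3 : (msupp (c *: g1 + g2) `<=` d)%fset.
  apply: fsubset_trans (msuppD_le _ _) _; apply: fsetUSS => //.
  exact: msuppZ_le.
rewrite (lin_extEw le1) (lin_extEw le2) (lin_extEw le3) scaler_sumr -big_split.
by apply: eq_bigr => k _ /=; rewrite mcoeffD mcoeffZ scalerDl scalerA.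
Qed.

HB.instance Definition _ :=
  GRing.isLinear.Build rat {malg rat[K]} V *:%R lin_ext lin_ext_is_linear.

Lemma lin_extU k : lin_ext << k >> = h k.
Proof.
rewrite (@lin_extEw [fset k]%fset); last exact: msuppU_le.
by rewrite big_seq_fset1 mcoeffUU scale1r.
Qed.
End LinExt.

Section Tensor.
Variables K L : choiceType.

Definition tens (v : {malg rat[K]}) (w : {malg rat[L]}) :
    {malg rat[(K * L)%type]} :=
  lin_ext (fun a => lin_ext (fun b => << (a, b) >>) w) v.

Lemma tensUU a b : tens << a >> << b >> = << (a, b) >>.
Proof. by rewrite /tens !lin_extU. Qed.

Lemma tens_linearl w : linear (tens^~ w).
Proof. by move=> c v1 v2; rewrite /tens linearP. Qed.

Lemma tens_linearr v : linear (tens v).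
Proof.
move=> c w1 w2; rewrite /tens /lin_ext scaler_sumr -big_split /=.
apply: eq_bigr => a _; rewrite -!/(lin_ext _ _) linearP scalerDr !scalerA.
by rewrite mulrC.
Qed.
End Tensor.

Lemma tens_mulUU (K L : conomType) (a c : K) (b d : L) :
  tens << a >> << b >> * tens << c >> << d >> =
  tens << mmul a c >> << mmul b d >>.
Proof.
rewrite (tensUU a b) (tensUU c d) (tensUU (mmul a c)) malgM_def.
by rewrite (fgmulUU 1 1 (a, b) (c, d)) mulr1.
Qed.

Definition tens_map (K L K' L' : choiceType)
    (F : {malg rat[K]} -> {malg rat[K']}) (G : {malg rat[L]} -> {malg rat[L']}) :
    {malg rat[(K * L)%type]} -> {malg rat[(K' * L')%type]} :=
  lin_ext (fun p => tens (F << p.1 >>) (G << p.2 >>)).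

Lemma tens_map_tens (K L K' L' : choiceType)
    (F : {linear {malg rat[K]} -> {malg rat[K']}})
    (G : {linear {malg rat[L]} -> {malg rat[L']}}) v w :
  tens_map F G (tens v w) = tens (F v) (G w).
Proof.
have -> : tens v w = \sum_(a <- msupp v) v@_a *:
    \sum_(b <- msupp w) w@_b *: << (a, b) >> by [].
have tlE c a s u : tens (c *: a + s) u = c *: tens a u + tens s u
    :> {malg rat[(K' * L')%type]}.
  exact: (tens_linearl u c a s).
have trE c u a s : tens u (c *: a + s) = c *: tens u a + tens u s
    :> {malg rat[(K' * L')%type]}.
  exact: (tens_linearr u c a s).
rewrite /tens_map linear_sum [in RHS](monalgE v) linear_sum /=.
elim: (msupp v : seq _) => [|a s IH]; first by rewrite !big_nil /tens linear0.
rewrite !big_cons IH (malgUZ v@_a) !linearZ /= tlE; congr (_ *: _ + _).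
rewrite linear_sum [in RHS](monalgE w) linear_sum /=.
elim: (msupp w : seq _) => [|b r IHr].
  have := trE (-1) (F << a >>) 0 0.
  by rewrite !big_nil scaler0 addr0 scaleN1r addNr.
by rewrite !big_cons IHr (malgUZ w@_b) !linearZ /= trE lin_extU.
Qed.

(* Rooted trees: a non-planar tree is represented by its unique planar        *)
(* representative whose sequences of children are sorted, recursively, for    *)
(* an arbitrary fixed total order on planar trees.                            *)
Inductive ptree := PNode of seq ptree.

Fixpoint ptree_encode (t : ptree) : GenTree.tree void :=
  let: PNode s := t in GenTree.Node 0 (map ptree_encode s).

Fixpoint ptree_decode (t : GenTree.tree void) : ptree :=
  if t is GenTree.Node _ s then PNode (map ptree_decode s) else PNode [::].

Lemma ptree_nested_ind (P : ptree -> Prop) :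
  (forall s, foldr (fun t => and (P t)) True s -> P (PNode s)) ->
  forall t, P t.
Proof.
move=> H; fix IH 1 => -[s]; apply: H.
by elim: s => [|t s IHs] //=.
Qed.

Lemma ptree_encodeK : cancel ptree_encode ptree_decode.
Proof.
elim/ptree_nested_ind => s IHs /=; congr PNode.
by elim: s IHs => //= t s IH [-> /IH ->].
Qed.

HB.instance Definition _ := Countable.copy ptree (can_type ptree_encodeK).

Lemma ptree_ind_mem (P : ptree -> Prop) :
  (forall s, (forall t, t \in s -> P t) -> P (PNode s)) -> forall t, P t.
Proof.
move=> H; elim/ptree_nested_ind => s IHs; apply: H.
elim: s IHs => //= t s IH [Pt /IH Ps] t'; rewrite inE => /orP[/eqP->//|].
exact: Ps.
Qed.

Definition ptree_le : rel ptree := relpre choice.pickle leq.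

Lemma ptree_le_total : total ptree_le.
Proof. by move=> s t; exact: leq_total. Qed.

Lemma ptree_le_trans : transitive ptree_le.
Proof. by move=> s t u; exact: leq_trans. Qed.

Lemma ptree_le_anti : antisymmetric ptree_le.
Proof.
move=> s t /anti_leq E; apply: (pcan_inj (@choice.pickleK _)); exact: E.
Qed.

Fixpoint normal (t : ptree) : bool :=
  let: PNode s := t in sorted ptree_le s && all normal s.

Record rtree := RTree { planar : ptree; planar_normal : normal planar }.

HB.instance Definition _ := [isSub for planar].
HB.instance Definition _ := [Countable of rtree by <:].

(* A forest is a finite multiset of rooted trees; [mone] is the empty forest, *)
(* [mmul] the disjoint union and [tree1 t] the forest reduced to the tree t.  *)
Definition forest := {cmonom rtree}.

Definition tree1 (t : rtree) : forest := ucm t.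

Definition forest_enum (f : forest) : seq rtree :=
  flatten [seq nseq (f t) t | t <- finsupp f].

Definition forest_of_seq (s : seq rtree) : forest :=
  foldr (fun t f => mmul (tree1 t) f) mone s.

Definition Bplus_planar (f : forest) : ptree :=
  PNode (sort ptree_le (map planar (forest_enum f))).

Lemma Bplus_normal f : normal (Bplus_planar f).
Proof.
rewrite /= sort_sorted ?all_sort /=; last exact: ptree_le_total.
by apply/allP => _ /mapP[t _ ->]; exact: planar_normal.
Qed.

Definition Bplus (f : forest) : rtree := RTree (Bplus_normal f).

Lemma count_forest_enum (f : forest) t : count_mem t (forest_enum f) = f t.
Proof.
rewrite /forest_enum count_flatten -map_comp sumnE big_map /=.
under eq_bigr do rewrite count_nseq.
case: (finsuppP f t) => [ft0|tf].
  rewrite big_seq big1 // => u uf /=; case: eqP => [E|]; last by rewrite mul0n.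
  by rewrite -E uf in ft0.
rewrite (big_fsetD1 t) //= eqxx mul1n big_seq_cond big1 ?addn0 //.
by move=> u /andP[]; rewrite in_fsetD1 => /andP[/negbTE-> _] _; rewrite mul0n.
Qed.

Lemma forest_of_seqE s t : forest_of_seq s t = count_mem t s.
Proof.
elim: s => [|u s IH] /=; first by rewrite onecmE.
by rewrite mulcmE IH ucmE.
Qed.

Lemma forest_of_seqK s : perm_eq (forest_enum (forest_of_seq s)) s.
Proof.
by apply/allP => t _; rewrite /= count_forest_enum forest_of_seqE.
Qed.

Lemma forest_enumK : cancel forest_enum forest_of_seq.
Proof.
by move=> f; apply/eqP/cmP => t; rewrite forest_of_seqE count_forest_enum.
Qed.

Lemma Bplus_inj : injective Bplus.
Proof.
move=> f g [E].
have /perm_map_inj P : perm_eq (map planar (forest_enum f))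
                               (map planar (forest_enum g)).
  by rewrite -(perm_sort ptree_le) E perm_sort.
apply/eqP/cmP => t; rewrite -!count_forest_enum.
by have /permP -> := P val_inj.
Qed.

Lemma Bplus_surj t : exists f, Bplus f = t.
Proof.
case: t => -[s] Hs; have := Hs => /= /andP[sort_s /allP all_s].
have [r def_s] : exists r : seq rtree, map planar r = s.
  exists (pmap insub s); elim: s all_s {Hs sort_s} => //= t s IH all_s.
  rewrite insubT ?all_s ?mem_head //= => Ht; rewrite IH // => u us.
  by rewrite all_s // inE us orbT.
exists (forest_of_seq r); apply: val_inj; rewrite /= /Bplus_planar; congr PNode.
apply: (sorted_eq ptree_le_trans ptree_le_anti) => //.
  by rewrite sort_sorted //; exact: ptree_le_total.
by rewrite perm_sort -def_s; apply/perm_map/forest_of_seqK.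
Qed.

(* The (Connes-Kreimer) algebra of rooted forests, and its tensor square. *)
Notation CK := {malg rat[forest]}.
Notation CK2 := {malg rat[(forest * forest)%type]}.

Definition BplusH : CK -> CK := lin_ext (fun f => << tree1 (Bplus f) >>).

Definition id_Bplus : CK2 -> CK2 := tens_map idfun BplusH.

HB.instance Definition _ := GRing.Linear.on BplusH.
HB.instance Definition _ := GRing.Linear.on id_Bplus.

Fixpoint unplanar (t : ptree) : rtree :=
  let: PNode s := t in
  Bplus (foldr (fun t f => mmul (tree1 (unplanar t)) f) mone s).

(* Structural recursion, on planar representatives, for the equation          *)
(*   Delta (B_+ (t_1 .. t_n))                                                 *)
(*     = B_+ (t_1 .. t_n) (x) 1 + (id (x) B_+) (Delta t_1 .. Delta t_n).      *)
Fixpoint coprod_planar (t : ptree) : CK2 :=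
  let: PNode s := t in
  tens << tree1 (unplanar t) >> 1 +
  id_Bplus (foldr (fun t D => coprod_planar t * D) 1 s).

Definition coprod_forest (f : forest) : CK2 :=
  \prod_(t <- forest_enum f) coprod_planar (planar t).

Definition Delta : CK -> CK2 := lin_ext coprod_forest.

HB.instance Definition _ := GRing.Linear.on Delta.

Lemma unplanarK : cancel planar unplanar.
Proof.
suff H t : normal t -> planar (unplanar t) = t.
  by case=> t Ht; apply: val_inj; exact: H.
elim/ptree_ind_mem: t => s IHs Hs.
have -> : unplanar (PNode s) =
    Bplus (forest_of_seq (map unplanar s)).
  by rewrite /= /forest_of_seq foldr_map.
have E : map planar (map unplanar s) = s.
  rewrite -map_comp map_id_in // => t ts /=; apply: IHs => //.
  by move: Hs => /= /andP[_ /allP]; apply.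
rewrite /= /Bplus_planar; congr PNode.
apply: (sorted_eq ptree_le_trans ptree_le_anti).
- by rewrite sort_sorted //; exact: ptree_le_total.
- by move: Hs => /= /andP[].
by rewrite perm_sort -[X in perm_eq _ X]E; apply/perm_map/forest_of_seqK.
Qed.

Lemma DeltaU f : Delta << f >> = coprod_forest f.
Proof. exact: lin_extU. Qed.

Lemma coprod_forest_perm f s : perm_eq (forest_enum f) s ->
  coprod_forest f = \prod_(t <- s) coprod_planar (planar t).
Proof. exact: perm_big. Qed.

Lemma coprod_forest1 : coprod_forest mone = 1.
Proof.
rewrite (@coprod_forest_perm _ [::]) ?big_nil //.
by apply: (forest_of_seqK [::]).
Qed.

Lemma coprod_forestM f g :
  coprod_forest (mmul f g) = coprod_forest f * coprod_forest g.
Proof.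
rewrite (@coprod_forest_perm _ (forest_enum f ++ forest_enum g)) ?big_cat //.
by apply/allP => t _ /=; rewrite count_cat !count_forest_enum mulcmE.
Qed.

Lemma Delta_is_multiplicative : multiplicative Delta.
Proof.
split=> [g1 g2|]; last by rewrite DeltaU coprod_forest1.
rewrite malgME linear_sum /= {2 3}/Delta /lin_ext mulr_suml.
apply: eq_bigr => f _; rewrite linear_sum mulr_sumr; apply: eq_bigr => g _.
by rewrite malgUZ linearZ [LHS]/= DeltaU coprod_forestM -scalerAl -scalerAr scalerA.
Qed.

HB.instance Definition _ :=
  GRing.isMultiplicative.Build CK CK2 Delta Delta_is_multiplicative.

Lemma coprod_planarE s :
  coprod_planar (PNode s) =
  tens << tree1 (unplanar (PNode s)) >> 1 +
  id_Bplus (\prod_(t <- s) coprod_planar t).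
Proof.
have -> : \prod_(t <- s) coprod_planar t =
    foldr (fun t D => coprod_planar t * D) 1 s.
  by elim: s => [|t s IH]; rewrite ?big_nil // big_cons IH.
exact: erefl.
Qed.

Lemma Delta_Bplus (f : forest) :
  Delta << tree1 (Bplus f) >> =
  tens << tree1 (Bplus f) >> 1 + id_Bplus (Delta << f >>).
Proof.
have enum1 : perm_eq (forest_enum (tree1 (Bplus f))) [:: Bplus f].
  by apply/allP => t _ /=; rewrite count_forest_enum ucmE addn0.
pose s := sort ptree_le (map planar (forest_enum f)).
have EB : unplanar (PNode s) = Bplus f by exact: unplanarK (Bplus f).
have ED : \prod_(t <- s) coprod_planar t = coprod_forest f.
  by rewrite /s (perm_big _ (permEl (perm_sort _ _))) big_map.
have E1 : Delta << tree1 (Bplus f) >> = coprod_planar (PNode s).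
  by rewrite (DeltaU (tree1 _)) (coprod_forest_perm enum1) big_seq1.
apply: etrans E1 _; apply: etrans (coprod_planarE s) _; rewrite EB ED.
by congr (_ + id_Bplus _); exact: esym (DeltaU f).
Qed.

Variant letter := Lx | Ly.

Definition letter_is_y (l : letter) : bool := if l is Ly then true else false.
Definition letter_of_bool (b : bool) : letter := if b then Ly else Lx.
Lemma letter_is_yK : cancel letter_is_y letter_of_bool.
Proof. by case. Qed.

HB.instance Definition _ := Countable.copy letter (can_type letter_is_yK).

Notation word := {fmonom letter}.
Notation Qxy := {malg rat[word]}.

Definition x : Qxy := << fmu Lx >>.
Definition y : Qxy := << fmu Ly >>.
Definition z : Qxy := x + y.

Definition Rmul (u w : Qxy) : Qxy := w * u.

(* R_y^-1 : wy |-> w, extended by 0 on the words not ending in y.             *)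
Definition Ry_inv : Qxy -> Qxy :=
  lin_ext (fun w : word =>
    if rev w is Ly :: s then << FMonom (rev s) >> else 0).

HB.instance Definition _ := GRing.Linear.on Ry_inv.

Lemma Ry_invK : cancel (Rmul y) Ry_inv.
Proof.
move=> v; rewrite /Rmul /Ry_inv [in LHS](monalgE v) mulr_suml linear_sum /=.
rewrite [RHS]monalgE; apply: eq_bigr => w _.
rewrite (malgUZ v@_w) -scalerAl linearZ /=; congr (_ *: _).
have -> : << w >> * y = << FMonom (rcons w Ly) >> :> Qxy.
  rewrite malgM_def fgmulUU mulr1; congr mkmalgU; apply: val_inj => /=.
  by rewrite -cats1 fmM fmU.
by rewrite lin_extU /= rev_rcons revK; congr mkmalgU; exact: val_inj.
Qed.

(* Multiplication Qxy (x) Qxy -> Qxy, v (x) w |-> vw. *)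
Definition M : {malg rat[(word * word)%type]} -> Qxy :=
  lin_ext (fun p => << mmul p.1 p.2 >>).

HB.instance Definition _ := GRing.Linear.on M.

Lemma M_tens v w : M (tens v w) = v * w.
Proof.
have -> : tens v w = \sum_(a <- msupp v) v@_a *:
    \sum_(b <- msupp w) w@_b *: << (a, b) >> by [].
rewrite /M linear_sum [in RHS](monalgE v) mulr_suml /=.
apply: eq_bigr => a _; rewrite (malgUZ v@_a) linearZ -scalerAl /=.
congr (_ *: _); rewrite linear_sum [in RHS](monalgE w) mulr_sumr /=.
apply: eq_bigr => b _; rewrite (malgUZ w@_b) linearZ malgZAr /=.
by congr (_ *: _); rewrite lin_extU malgM_def fgmulUU mulr1.
Qed.

(* For phi attaching a linear map to each forest and D = sum a (x) b,         *)
(* [tens_act phi D] is the map v (x) w |-> sum a(v) (x) b(w).                 *)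
Definition tens_act (phi : forest -> {linear Qxy -> Qxy}) (D : CK2)
    (T : {malg rat[(word * word)%type]}) : {malg rat[(word * word)%type]} :=
  lin_ext (fun p : forest * forest => tens_map (phi p.1) (phi p.2) T) D.

Definition bullet : forest := tree1 (Bplus mone).

(* Main.v *)
(* The maps of nonempty forests kill z = x + y, and all commute with R_z, so  *)
(* a map F is determined by F(1) and its conjugate F^, where F R_y = R_y F^.  *)
(* In these terms (ii) forces the map attached to B_+(f) to be the unique T   *)
(* with T(1) = 0, T(wz) = T(w)z and                                           *)
(*   T(wy) = (T(w) + f^(w)(y + z) - 2 f(w)z)y,                                *)
(* which defines tree maps recursively, and forest maps by composition. The   *)
(* crux is that tree maps commute: for T, S attached to B_+(f), B_+(g), the   *)
(* commutator satisfies [T, S]R_y = R_y[T^, S^], and [T^, S^] = [T, S] as     *)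
(* soon as f commutes with g and S, and g with T; hence induction on trees    *)
(* and on word length. Then f(vw) = M(Delta(f)(v (x) w)) holds for all v, w,  *)
(* by induction on f and on the length of w.                                  *)

Require Import Defs.
From HB Require Import structures.
From mathcomp Require Import all_boot all_order all_algebra.
From mathcomp.multinomials Require Import monalg.

Set Implicit Arguments.
Unset Strict Implicit.
Unset Printing Implicit Defensive.

Import GRing.Theory.
Local Open Scope ring_scope.

(** Expanding Delta(B_+(f)) with sum a (x) b = Delta(f), property (ii) at wy demands B_+(f)(wy) =
    B_+(f)(w)y + sum a(w) B_+(b)(y). Properties (i) and (i') say that B_+(b)(y) is [shift] of b at
    1, times y, for b empty or not; summing over the coproduct gives the recursion [graft_y].
    Composing the resulting tree maps is legitimate on multisets because they commute
    ([tree_map_comm], resting on [graft_comm]). Then [forest_map_coact] recovers (ii), and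
    [forest_map_Bplus_letter] reads (i') off the recursion at w = 1. *)

(** * Linear extension from a basis *)

Section LinExtTheory.
Variables (K : choiceType) (V : lmodType rat).
Implicit Types (h : K -> V) (g : {malg rat[K]}).

Lemma eq_lin_ext h1 h2 : h1 =1 h2 -> lin_ext h1 =1 lin_ext h2.
Proof. by move=> h12 g; apply: eq_bigr => k _; rewrite h12. Qed.

Lemma lin_ext0 g : lin_ext (fun=> 0 : V) g = 0.
Proof. by rewrite /lin_ext big1 // => k _; rewrite scaler0. Qed.

Lemma lin_extD h1 h2 g :
  lin_ext (fun k => h1 k + h2 k) g = lin_ext h1 g + lin_ext h2 g.
Proof.
by rewrite /lin_ext -big_split; apply: eq_bigr => k _; rewrite scalerDr.
Qed.

Lemma lin_extZ c h g : lin_ext (fun k => c *: h k) g = c *: lin_ext h g.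
Proof.
by rewrite /lin_ext scaler_sumr; apply: eq_bigr => k _; rewrite !scalerA mulrC.
Qed.

Lemma linear_lin_ext (W : lmodType rat) (L : {linear V -> W}) h g :
  L (lin_ext h g) = lin_ext (fun k => L (h k)) g.
Proof. by rewrite linear_sum; apply: eq_bigr => k _; rewrite linearZ. Qed.

End LinExtTheory.

Lemma eq_on_basis (K : choiceType) (V : lmodType rat)
    (F G : {malg rat[K]} -> V) : linear F -> linear G ->
  (forall k, F << k >> = G << k >>) -> F =1 G.
Proof.
move=> linF linG FG g.
pose LF := GRing.isLinear.Build rat {malg rat[K]} V *:%R F linF.
pose LG := GRing.isLinear.Build rat {malg rat[K]} V *:%R G linG.
pose F' : {linear {malg rat[K]} -> V} := HB.pack F LF.
pose G' : {linear {malg rat[K]} -> V} := HB.pack G LG.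
rewrite -[F]/(F' : _ -> _) -[G]/(G' : _ -> _) (monalgE g) !linear_sum.
by apply: eq_bigr => k _; rewrite malgUZ !linearZ /= FG.
Qed.

Lemma lin_ext_mull (K : choiceType) (A : lalgType rat) (h : K -> A) g u :
  lin_ext (fun k => h k * u) g = lin_ext h g * u.
Proof. by rewrite mulr_suml; apply: eq_bigr => k _; rewrite scalerAl. Qed.

Lemma lin_extM (K : monomType) (V : lmodType rat) (h : K -> V) g1 g2 :
  lin_ext h (g1 * g2) =
  lin_ext (fun b => lin_ext (fun a => h (mmul a b)) g1) g2.
Proof.
rewrite malgME exchange_big linear_sum; apply: eq_bigr => a _.
rewrite linear_sum /= scaler_sumr; apply: eq_bigr => b _.
by rewrite malgUZ linearZ /= lin_extU scalerA mulrC.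
Qed.

Lemma linear_mulr_comp (A : lalgType rat) (F : {linear A -> A}) u :
  linear (fun w => F (w * u)).
Proof. by move=> c v w; rewrite mulrDl -scalerAl linearP. Qed.

Lemma linear_mulr_add (A : lalgType rat) (F G : A -> A) c u v :
  linear F -> linear G -> linear (fun w => F w * u + c *: (G w * v)).
Proof.
move=> linF linG d w1 w2; rewrite linF linG !mulrDl -!scalerAl !scalerDr.
by rewrite addrACA !scalerA mulrC.
Qed.

(** * Symmetry of products of conjugated grafts *)

Section GraftStep.
Variables (R : nzRingType) (A : lalgType R) (y z : A).
Variables (F G F' G' : {linear A -> A}).
Variables (f g f' g' : A -> A).

Let p w := f' w * (y + z) - F' w * z *+ 2.
Let q w := g' w * (y + z) - G' w * z *+ 2.

(* Here [f], [g], [f'], [g'] stand for the conjugates by R_y of [F], [G],     *)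
(* [F'], [G'], so that [p = f - F] and [q = g - G]. When [F'] commutes with   *)
(* [G'] and [G], and [G'] with [F], both right-hand sides below become        *)
(* symmetric under exchanging [F, F'] with [G, G'].                           *)
Lemma shift_swap w :
  (forall v, F' (v * y) = f' v * y) -> (forall v, F' (v * z) = F' v * z) ->
  p (g' w) + F' (q w) *+ 2 =
  f' (g' w) * (y + z) + f' (g' w) * y *+ 2 - F' (G' w) * z *+ 4.
Proof.
move=> F'y F'z; rewrite /p /q (linearB F') (linearMn F') !mulrDr.
rewrite (linearD F') F'y !F'z.
rewrite mulrnBl [in LHS]mulrnDl -mulrnA.
by rewrite [LHS](AC (3*3) (1*2*4*(3*5)*6)) /= addNr addr0.
Qed.

Lemma hat_hat w :
  (forall v, f v = F v + p v) -> (forall v, g v = G v + q v) ->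
  (forall v, F (v * y) = f v * y) -> (forall v, F (v * z) = F v * z) ->
  f (g w) = F (G w) + ((f (g' w) + f' (g w)) * y +
    (f (g' w) + f' (g w) - (F (G' w) + F' (G w)) *+ 2
      - (p (g' w) + F' (q w) *+ 2)) * z).
Proof.
move=> fE gE Fy Fz.
have -> : f (g w) = F (G w) + F (q w) + p (g w).
  by rewrite fE -(linearD F) -gE.
rewrite -addrA; congr (_ + _).
have -> : F (q w) = f (g' w) * y + F (g' w) * z - F (G' w) * z *+ 2.
  by rewrite /q (linearB F) (linearMn F) !mulrDr (linearD F) Fy !Fz.
have -> : p (g w) = f' (g w) * y + f' (g w) * z -
    (F' (G w) + F' (q w)) * z *+ 2.
  by rewrite /p mulrDr -(linearD F') -gE.
(* Trading [F] for its conjugate here isolates the combination of [p] and [q] that [shift_swap]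
   evaluates. *)
have -> : F (g' w) = f (g' w) - p (g' w) by rewrite fE addrK.
move: (f (g' w)) (f' (g w)) (F (G' w)) (F' (G w)) (p _) (F' _) => U V Q Q' P N.
rewrite !mulr2n !(mulrBl, mulrDl) !opprD.
by rewrite [LHS](AC (((1*2)*2)*(2*(2*2)))
                    ((1*6)*(((2*7)*((4*8)*(5*10)))*(3*(9*11))))).
Qed.

End GraftStep.

Lemma DeltaM (f g : forest) :
  Delta << mmul f g >> = Delta << f >> * Delta << g >>.
Proof.
transitivity (coprod_forest f * coprod_forest g).
  by apply: etrans (DeltaU _) _; exact: coprod_forestM.
move: (DeltaU f) (DeltaU g).
move: (coprod_forest f) (coprod_forest g) => a b Ea Eb.
exact: (f_equal2 (fun u v : CK2 => u * v) (esym Ea) (esym Eb)).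
Qed.

(** A forest is a product of trees, each [Bplus] of a forest of smaller trees, so the claim follows
    by induction on planar trees, carried over by [unplanar]. *)
Lemma forest_ind (P : forest -> Prop) : P mone ->
  (forall f, P f -> P (tree1 (Bplus f))) ->
  (forall f g, P f -> P g -> P (mmul f g)) -> forall f, P f.
Proof.
move=> P1 PB PM.
have Pseq (s : seq rtree) :
    (forall t, t \in s -> P (tree1 t)) -> P (forest_of_seq s).
  elim: s => //= t s IH Ps; apply: PM; first exact/Ps/mem_head.
  by apply: IH => u us; apply: Ps; rewrite inE us orbT.
have Ptree t : P (tree1 (unplanar t)).
  elim/ptree_ind_mem: t => s IH.
  have -> : unplanar (PNode s) = Bplus (forest_of_seq (map unplanar s)).
    by rewrite /= /forest_of_seq foldr_map.
  by apply/PB/Pseq => _ /mapP[t ts ->]; exact: IH.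
move=> f; rewrite -[f]forest_enumK; apply: Pseq => t _.
by rewrite -(unplanarK t).
Qed.

(** * Tree and forest maps over an abstract algebra *)

Section TreeMaps.
Variables (A : algType rat) (y z : A) (Rinv : {linear A -> A}).
Hypothesis RinvK : cancel (fun v => v * y) Rinv.
(** Stands for induction on the length of words in y and z. *)
Hypothesis linear_eq : forall F G : A -> A, linear F -> linear G ->
  F 1 = G 1 ->
  (forall w, F w = G w -> F (w * z) = G (w * z)) ->
  (forall w, F w = G w -> F (w * y) = G (w * y)) -> F =1 G.

Definition hat (F : A -> A) (w : A) : A := Rinv (F (w * y)).

Lemma hatE (F : A -> A) w v : F (w * y) = v * y -> hat F w = v.
Proof. by rewrite /hat => ->; exact: RinvK. Qed.

(** The first clause says that [F] preserves the left ideal Ay, so that [hat F] is a genuine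
    conjugate. *)
Definition stable (F : A -> A) :=
  (forall w, F (w * y) = hat F w * y) /\ (forall w, F (w * z) = F w * z).

Lemma hat_comp F G w : stable F -> stable G ->
  F (G (w * y)) = hat F (hat G w) * y.
Proof. by move=> [FE _] [GE _]; rewrite GE FE. Qed.

Lemma stable_comp F G : stable F -> stable G -> stable (F \o G).
Proof.
move=> sF sG; have [[_ Fz] [_ Gz]] := (sF, sG).
split=> w /=; last by rewrite Gz Fz.
by rewrite (hatE (hat_comp w sF sG)) hat_comp.
Qed.

Lemma stable_id : stable id.
Proof. by split=> // w; rewrite (@hatE id w w). Qed.

Lemma hat_comm F G : stable F -> stable G ->
  (forall w, F (G w) = G (F w)) -> forall w, hat F (hat G w) = hat G (hat F w).
Proof.
move=> sF sG FG w; apply: (can_inj RinvK) => /=.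
by rewrite -(hat_comp w sF sG) -(hat_comp w sG sF) FG.
Qed.

(** The term in 2z covers the empty forest: at w = 1 it vanishes for nonempty forests, while the
    identity gives y - z = -x, matching the value of [bullet] on y. *)
Definition shift (F : A -> A) (w : A) : A := hat F w * (y + z) - F w * z *+ 2.

Lemma shift_linear (F : {linear A -> A}) : linear (shift F).
Proof.
move=> c v w; rewrite /shift /hat mulrDl -scalerAl !linearP !mulrDl -!scalerAl.
by rewrite mulrnDl scalerBr scalerMnr opprD addrACA.
Qed.

Variable graft : {linear A -> A} -> {linear A -> A}.
Hypothesis graft1 : forall F, graft F 1 = 0.
Hypothesis graft_z : forall F w, graft F (w * z) = graft F w * z.
Hypothesis graft_y : forall F w,
  graft F (w * y) = (graft F w + shift F w) * y.

Lemma hat_graft F w : hat (graft F) w = graft F w + shift F w.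
Proof. exact/hatE/graft_y. Qed.

Lemma stable_graft F : stable (graft F).
Proof. by split=> w; rewrite ?graft_z // hat_graft graft_y. Qed.

Lemma eq_graft (F G : {linear A -> A}) : F =1 G -> graft F =1 graft G.
Proof.
move=> FG; apply: linear_eq => [||||w E]; try exact: linearP.
- by rewrite !graft1.
- by move=> w E; rewrite !graft_z E.
- by rewrite !graft_y E /shift /hat !FG.
Qed.

(** Both composites kill 1 and commute with right multiplication by z. On wy, [hat_hat] and
    [shift_swap] show that the conjugated products differ from the products at w by the same
    symmetric expression. *)
Lemma graft_comm (F' G' : {linear A -> A}) : stable F' -> stable G' ->
  (forall w, F' (G' w) = G' (F' w)) ->
  (forall w, F' (graft G' w) = graft G' (F' w)) ->
  (forall w, G' (graft F' w) = graft F' (G' w)) ->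
  forall w, graft F' (graft G' w) = graft G' (graft F' w).
Proof.
move=> sF' sG' FG' F'G G'F.
have sF := stable_graft F'; have sG := stable_graft G'.
have hFG' := hat_comm sF' sG' FG'.
have hF'G := hat_comm sF' sG F'G; have hG'F := hat_comm sG' sF G'F.
have [[F'y F'z] [G'y G'z]] := (sF', sG').
have [[Fy Fz] [Gy Gz]] := (sF, sG).
apply: (@linear_eq (graft F' \o graft G') (graft G' \o graft F')) => [||||w E].
- exact: linearP.
- exact: linearP.
- by rewrite /= !graft1 !linear0.
- by move=> w E; rewrite /= !graft_z; congr (_ * z).
rewrite /= (hat_comp w sF sG) (hat_comp w sG sF); congr (_ * y).
rewrite (hat_hat w (hat_graft F') (hat_graft G') Fy Fz).
rewrite (hat_hat w (hat_graft G') (hat_graft F') Gy Gz).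
rewrite /= in E; rewrite E (shift_swap G' _ w F'y F'z).
rewrite (shift_swap F' _ w G'y G'z).
rewrite hFG' FG' hF'G hG'F F'G G'F.
by rewrite [hat (graft F') _ + _]addrC [graft F' (G' w) + _]addrC.
Qed.

Definition comp_lin (F G : {linear A -> A}) : {linear A -> A} := F \o G.

Fixpoint tree_map (t : ptree) : {linear A -> A} :=
  let: PNode s := t in
  graft (foldr (fun t => comp_lin (tree_map t)) idfun s).

Definition seq_map (s : seq ptree) : {linear A -> A} :=
  foldr (fun t => comp_lin (tree_map t)) idfun s.

Lemma tree_map_stable t : stable (tree_map t).
Proof. by case: t => s; exact: stable_graft. Qed.

Lemma seq_map_stable s : stable (seq_map s).
Proof.
elim: s => [|t s IH]; first exact: stable_id.
exact: (stable_comp (tree_map_stable t) IH).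
Qed.

Lemma seq_map_comm (F : A -> A) s :
  (forall t, t \in s -> forall w, tree_map t (F w) = F (tree_map t w)) ->
  forall w, seq_map s (F w) = F (seq_map s w).
Proof.
elim: s => // t s IH tF w; rewrite /= IH ?tF ?mem_head // => u us.
by apply: tF; rewrite inE us orbT.
Qed.

(** Nested induction: the outer hypothesis compares children of [t] with any tree, the inner one
    compares [t] itself with children of [u]. *)
Lemma tree_map_comm t u w :
  tree_map t (tree_map u w) = tree_map u (tree_map t w).
Proof.
elim/ptree_ind_mem: t u w => s IHs; elim/ptree_ind_mem=> r IHr.
apply: (@graft_comm (seq_map s) (seq_map r)).
- exact: seq_map_stable.
- exact: seq_map_stable.
- apply: seq_map_comm => t ts w; apply/esym/seq_map_comm => u ur v.
  exact/esym/IHs.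
- by apply: seq_map_comm => t ts w; exact: (IHs t ts (PNode r)).
- by apply: seq_map_comm => t tr w; exact/esym/(IHr t tr).
Qed.

Lemma seq_map_cat s r w : seq_map (s ++ r) w = seq_map s (seq_map r w).
Proof. by elim: s => //= t s ->. Qed.

Lemma eq_seq_map s r : perm_eq s r -> seq_map s =1 seq_map r.
Proof.
move=> sr.
apply: (catCA_perm_ind _ sr (P := fun r => seq_map s =1 seq_map r)) => //.
move=> s1 s2 s3 E w; rewrite E !seq_map_cat.
apply: (@seq_map_comm (seq_map s2)) => t _ v.
apply/esym/seq_map_comm => u _ {}v.
exact: tree_map_comm.
Qed.

Definition forest_map (f : forest) : {linear A -> A} :=
  seq_map (map planar (forest_enum f)).

Lemma forest_map_perm f s w : perm_eq (forest_enum f) s ->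
  forest_map f w = seq_map (map planar s) w.
Proof. by move=> fs; apply/eq_seq_map/perm_map. Qed.

Lemma forest_map1 w : forest_map mone w = w.
Proof. by rewrite (forest_map_perm _ (forest_of_seqK [::])). Qed.

Lemma forest_mapM f g w :
  forest_map (mmul f g) w = forest_map f (forest_map g w).
Proof.
rewrite (@forest_map_perm _ (forest_enum f ++ forest_enum g)).
  by rewrite map_cat seq_map_cat.
by apply/allP => t _ /=; rewrite count_cat !count_forest_enum mulcmE.
Qed.

Lemma forest_map_Bplus f w :
  forest_map (tree1 (Bplus f)) w = graft (forest_map f) w.
Proof.
rewrite (@forest_map_perm _ [:: Bplus f]) /=; last first.
  by apply/allP => t _ /=; rewrite count_forest_enum ucmE addn0.
by apply: eq_graft; apply: eq_seq_map; rewrite perm_sort.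
Qed.

Lemma forest_map_stable f : stable (forest_map f).
Proof. exact: seq_map_stable. Qed.

(** By commutation some tree of the forest can be applied first, and it kills 1. *)
Lemma forest_map_vanish f : f <> mone -> forest_map f 1 = 0.
Proof.
rewrite -[f]forest_enumK /forest_map; case: (forest_enum f) => // t s _.
rewrite -/(forest_map _) (forest_map_perm _ (forest_of_seqK _)) /=.
suff T0 u : tree_map u 1 = 0.
  rewrite -(@seq_map_comm (tree_map (planar t))) ?T0 ?linear0 // => u _ w.
  exact: tree_map_comm.
by case: u => r; exact: graft1.
Qed.

Lemma stable_vanish_zy (F : {linear A -> A}) : stable F -> F 1 = 0 ->
  F (z - y) = - F y.
Proof. by case=> _ Fz F1; rewrite linearB -[z]mul1r Fz F1 mul0r sub0r. Qed.

(** At w = 1 the recursion loses every term containing [F 1], leaving [hat F 1 * (y + z) * y]; the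
    letter x = z - y follows by sign, since z is killed. *)
Lemma forest_map_Bplus_letter f u : f <> mone -> u = z - y \/ u = y ->
  (exists v, forest_map f u = v * y) /\
  forest_map (tree1 (Bplus f)) u = Rinv (forest_map f u) * (y + z) * y.
Proof.
move=> f1 u_letter; have F1 := forest_map_vanish f1.
have sF := forest_map_stable f.
have Fy : forest_map f y = hat (forest_map f) 1 * y.
  by have [<- _] := sF; rewrite mul1r.
have By : graft (forest_map f) y = hat (forest_map f) 1 * (y + z) * y.
  by rewrite -[y in LHS]mul1r graft_y graft1 add0r /shift F1 mul0r mul0rn subr0.
rewrite forest_map_Bplus; case: u_letter => ->.
  rewrite !stable_vanish_zy ?graft1 //; last exact: stable_graft.
  split; first by exists (- hat (forest_map f) 1); rewrite Fy mulNr.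
  by rewrite linearN By Fy (RinvK (hat _ 1)) !mulNr.
split; first by exists (hat (forest_map f) 1).
by rewrite By Fy (RinvK (hat _ 1)).
Qed.

Lemma forest_map_bullet_y : forest_map bullet y = - ((z - y) * y).
Proof.
rewrite -mulNr opprB forest_map_Bplus -[y in LHS]mul1r graft_y graft1 add0r.
congr (_ * y); rewrite /shift (@hatE _ _ 1); last by rewrite forest_map1.
by rewrite forest_map1 !mul1r mulr2n opprD addrA addrK.
Qed.

Lemma forest_map_bullet_zy : forest_map bullet (z - y) = (z - y) * y.
Proof.
rewrite (stable_vanish_zy (forest_map_stable _)) ?forest_map_bullet_y ?opprK //.
by rewrite forest_map_Bplus graft1.
Qed.

(** * The coproduct formula *)

Definition coact (D : CK2) (v w : A) : A :=
  lin_ext (fun p : forest * forest => forest_map p.1 v * forest_map p.2 w) D.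

Lemma coact_tree f v w :
  coact (Delta << tree1 (Bplus f) >>) v w = graft (forest_map f) v * w +
  lin_ext (fun p : forest * forest =>
    forest_map p.1 v * graft (forest_map p.2) w) (Delta << f >>).
Proof.
apply: etrans (congr1 (fun D => coact D v w) (Delta_Bplus f)) _.
apply: etrans (linearD (lin_ext _) _ _) _.
congr (_ + _).
  have -> : 1 = << mone >> :> CK by [].
  rewrite tensUU; apply: etrans (lin_extU _ _) _.
  by rewrite /= forest_map_Bplus forest_map1.
rewrite /id_Bplus /tens_map linear_lin_ext; apply: eq_lin_ext => -[a b] /=.
rewrite /BplusH lin_extU tensUU; apply: etrans (lin_extU _ _) _.
by rewrite /= forest_map_Bplus.
Qed.

(** The right factor is arbitrary because, for a product fg, the formula for f is applied to each
    a(v)b(w) produced by g. For [Bplus f], both sides obey the same recursion in w. *)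
Lemma forest_map_coact f v w :
  forest_map f (v * w) = coact (Delta << f >>) v w.
Proof.
elim/forest_ind: f v w => [|f IH|f g IHf IHg] v w.
- have -> : Delta << mone >> = << (mone, mone) >>.
    by rewrite DeltaU coprod_forest1.
  by rewrite /coact lin_extU /= !forest_map1.
- rewrite coact_tree forest_map_Bplus; move: w.
  have sf := forest_map_stable f; set D := Delta _; set F := forest_map f.
  pose S (h : forest -> A -> A) w :=
    lin_ext (fun p : forest * forest => forest_map p.1 v * h p.2 w) D.
  (* The formula for f at wy, cancelled by y, passes to [hat], hence to [shift]. *)
  have hatS w : hat F (v * w) = S (fun b => hat (forest_map b)) w.
    apply: hatE; rewrite -mulrA IH /coact /S -lin_ext_mull.
    apply: eq_lin_ext => p.
    by have [-> _] := forest_map_stable p.2; rewrite mulrA.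
  have shiftS w : shift F (v * w) = S (fun b => shift (forest_map b)) w.
    rewrite /shift hatS IH /S /coact -!lin_ext_mull -scaler_nat -scaleNr.
    rewrite -lin_extZ -lin_extD; apply: eq_lin_ext => p.
    by rewrite mulrBr mulrA scaleNr scaler_nat mulrnAr mulrA.
  apply: linear_eq => [c a b|c a b||w E|w E].
  + by rewrite mulrDr -scalerAr linearP.
  + rewrite mulrDr -scalerAr.
    pose h f := graft (forest_map f).
    have -> : lin_ext (fun p => forest_map p.1 v * h p.2 (c *: a + b)) D =
        c *: S (fun f => h f) a + S (fun f => h f) b.
      rewrite /S -lin_extZ -lin_extD; apply: eq_lin_ext => p.
      by rewrite linearP mulrDr -scalerAr.
    by rewrite scalerDr addrACA.
  + rewrite !mulr1 -[LHS]addr0; congr (_ + _); rewrite -[LHS](lin_ext0 _ D).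
    by apply: eq_lin_ext => p; rewrite graft1 mulr0.
  + rewrite (mulrA v) (mulrA (graft F v)) graft_z E mulrDl.
    rewrite -lin_ext_mull; congr (_ + _).
    by apply: eq_lin_ext => p; rewrite graft_z mulrA.
  + rewrite (mulrA v) (mulrA (graft F v)) graft_y E -addrA.
    rewrite mulrDl; congr (_ + _).
    rewrite shiftS /S -lin_extD -lin_ext_mull; apply: eq_lin_ext => p.
    by rewrite graft_y -mulrDr mulrA.
- rewrite forest_mapM IHg /coact linear_lin_ext.
  apply: esym; apply: etrans (congr1 (lin_ext _) (DeltaM f g)) _.
  apply: etrans (lin_extM _ _ _) _.
  apply: eq_lin_ext => p; rewrite IHf.
  by apply: eq_lin_ext => q; rewrite /= !forest_mapM.
Qed.

End TreeMaps.

(** * The instance of noncommutative polynomials *)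

Lemma Qxy_scalerAr (c : rat) (u v : Qxy) : c *: (u * v) = u * (c *: v).
Proof. by rewrite malgZAr. Qed.

(* Not declared canonical: [malg] already has a canonical [algType] instance, *)
(* restricted to commutative monoids.                                         *)
Definition Qxy_algType : algType rat :=
  HB.pack Qxy (GRing.Lalgebra_isAlgebra.Build rat Qxy Qxy_scalerAr).

Lemma Qxy_mul_letter (s : seq letter) (l : letter) :
  << FMonom (rcons s l) >> = << FMonom s >> * << fmu l >> :> Qxy.
Proof.
rewrite malgM_def fgmulUU mulr1; congr mkmalgU; apply: val_inj => /=.
by rewrite fmM fmU cats1.
Qed.

Lemma Qxy_1 : << FMonom [::] >> = 1 :> Qxy.
Proof.
by have -> : FMonom [::] = mone :> word by exact/val_inj/esym/fm1.
Qed.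

Lemma xE : x = z - y.
Proof. by rewrite /z addrK. Qed.

Lemma Qxy_linear_eq (F G : Qxy -> Qxy) : linear F -> linear G ->
  F 1 = G 1 ->
  (forall w, F w = G w -> F (w * z) = G (w * z)) ->
  (forall w, F w = G w -> F (w * y) = G (w * y)) -> F =1 G.
Proof.
move=> linF linG FG1 FGz FGy; apply: eq_on_basis => // -[s].
elim/last_ind: s => [|s l IH]; first by rewrite Qxy_1.
rewrite Qxy_mul_letter; case: l; last exact: FGy.
have -> : << FMonom s >> * << fmu Lx >> =
    -1 *: (<< FMonom s >> * y) + << FMonom s >> * z :> Qxy.
  by rewrite -/x xE mulrBr scaleN1r addrC.
move: (FGy _ IH) (FGz _ IH); move: (_ * y) (_ * z) => v w Ev Ew.
by rewrite linF linG Ev Ew.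
Qed.

Local Notation shiftQ := (@shift Qxy_algType y z Ry_inv).

(** Words are read from their last letter. The opposite signs for x and y make the correction cancel
    on z = x + y, which yields [graft_z]. *)
Fixpoint graft_rev (F : Qxy -> Qxy) (s : seq letter) : Qxy :=
  if s is l :: s' then
    graft_rev F s' * << fmu l >> +
    (-1) ^+ (l == Lx) *: (shiftQ F << FMonom (rev s') >> * y)
  else 0.

Definition graft (F : {linear Qxy -> Qxy}) : {linear Qxy -> Qxy} :=
  lin_ext (fun w : word => graft_rev F (rev w)).

Lemma graft1 F : graft F 1 = 0.
Proof. by rewrite -Qxy_1 [LHS]lin_extU. Qed.

Lemma graft_letter (F : {linear Qxy -> Qxy}) l (w : Qxy) :
  graft F (w * << fmu l >>) =
  graft F w * << fmu l >> + (-1) ^+ (l == Lx) *: (shiftQ F w * y).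
Proof.
move: w; apply: eq_on_basis.
- exact: (@linear_mulr_comp Qxy_algType).
- apply: (@linear_mulr_add Qxy_algType); first exact: linearP.
  exact: (@shift_linear Qxy_algType).
case=> s.
have gU r : graft F << FMonom r >> = graft_rev F (rev r) by exact: lin_extU.
by rewrite -Qxy_mul_letter !gU rev_rcons /= revK.
Qed.

Lemma graft_y (F : {linear Qxy -> Qxy}) (w : Qxy) :
  graft F (w * y) = (graft F w + shiftQ F w) * y.
Proof. by rewrite graft_letter expr0 scale1r [RHS]mulrDl. Qed.

Lemma graft_z (F : {linear Qxy -> Qxy}) (w : Qxy) :
  graft F (w * z) = graft F w * z.
Proof.
have zE v : v * z = v * << fmu Lx >> + v * << fmu Ly >> by exact: mulrDr.
rewrite !zE (linearD (graft F)).
apply: etrans (f_equal2 +%R (graft_letter F Lx w) (graft_letter F Ly w)) _.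
by rewrite expr1 scaleN1r expr0 scale1r addrACA addNr addr0.
Qed.

Theorem theorem1p1 :
  exists phi : forest -> {linear Qxy -> Qxy},
    (forall w : Qxy, phi mone w = w)
    /\ (phi bullet x = x * y /\ phi bullet y = - (x * y))
    /\ (forall f : forest, f <> mone -> forall u : Qxy, u = x \/ u = y ->
          (exists v : Qxy, phi f u = v * y)
          /\ phi (tree1 (Bplus f)) u
             = Rmul y (Rmul (y + z) (Ry_inv (phi f u))))
    /\ (forall f g h : forest, f = mmul g h -> g <> mone -> h <> mone ->
          forall u : Qxy, u = x \/ u = y -> phi f u = phi g (phi h u))
    /\ (forall f : forest, f <> mone ->
          forall w u : Qxy, u = x \/ u = y ->
            phi f (w * u) = M (tens_act phi (Delta << f >>) (tens w u))).
Proof.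
exists (@forest_map Qxy_algType graft); rewrite xE.
split; [|split; [split|split; [|split]]].
- exact: (@forest_map1 Qxy_algType _ _ _ Ry_invK Qxy_linear_eq graft
    graft1 graft_z graft_y).
- exact: (@forest_map_bullet_zy Qxy_algType _ _ _ Ry_invK Qxy_linear_eq graft
    graft1 graft_z graft_y).
- exact: (@forest_map_bullet_y Qxy_algType _ _ _ Ry_invK Qxy_linear_eq graft
    graft1 graft_z graft_y).
- move=> f f1 u u_letter.
  exact (@forest_map_Bplus_letter Qxy_algType _ _ _ Ry_invK Qxy_linear_eq graft
    graft1 graft_z graft_y f u f1 u_letter).
- move=> f g h -> _ _ u _.
  exact: (@forest_mapM Qxy_algType _ _ _ Ry_invK Qxy_linear_eq graft
    graft1 graft_z graft_y).
- move=> f _ w u _.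
  rewrite (@forest_map_coact Qxy_algType _ _ _ Ry_invK Qxy_linear_eq graft
    graft1 graft_z graft_y).
  rewrite /tens_act linear_lin_ext; apply: eq_lin_ext => p /=.
  by rewrite tens_map_tens M_tens.
Qed.
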